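(* For every $0<p<1$ the formal extension to exponent $p$ of the tangent inequality $$\|x+y\|_{L_p}^2\ \ge\ \|x\|_{L_p}^2+2\langle j_p(x),y\rangle+(p-1)\|y\|_{L_p}^2$$ has no fixed direction. More precisely, for every $0<p<1$ there exist a measure space $(\Omega,\mu)$ and pairs $(x,y)$ and $(x',y')$ in $L_p(\Omega;\mathbb R)$ such that $$\|x+y\|_{L_p}^2>\|x\|_{L_p}^2+2\langle j_p(x),y\rangle+(p-1)\|y\|_{L_p}^2$$ and $$\|x'+y'\|_{L_p}^2<\|x'\|_{L_p}^2+2\langle j_p(x'),y'\rangle+(p-1)\|y'\|_{L_p}^2 .$$
   Context: For $0<p<1$, $L_p(\Omega;\mathbb R)$ is the space of real measurable functions with $\|x\|_{L_p}=\left(\int_\Omega|x|^p\,d\mu\right)^{1/p}<\infty$ (a quasi-norm). The expression $\langle j_p(x),y\rangle$ is $$\langle j_p(x),y\rangle=\|x\|_{L_p}^{2-p}\int_\Omega|x|^{p-2}xy\,d\mu,$$ considered for pairs $(x,y)$ for which $x\neq0$ almost everywhere and the integral converges absolutely. *)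

(* Defs.v *)
From mathcomp Require Import all_boot all_order all_algebra.
From mathcomp Require Import all_classical all_reals all_analysis.
Set Implicit Arguments.
Unset Strict Implicit.
Unset Printing Implicit Defensive.
Import Order.TTheory GRing.Theory Num.Theory.
Local Open Scope classical_set_scope.
Local Open Scope ring_scope.

(* The library's type of L^p functions requires 1 <= p, whereas its (quasi-)norm
   [Lnorm] is defined for every exponent; only the latter is used here. *)
Definition in_Lp (d : measure_display) (T : measurableType d) (R : realType)
    (mu : {measure set T -> \bar R}) (p : R) (x : T -> R) : Prop :=
  measurable_fun setT x /\ finite_norm mu p%:E x.

Definition Lp_norm (d : measure_display) (T : measurableType d) (R : realType)
    (mu : {measure set T -> \bar R}) (p : R) (x : T -> R) : R :=
  fine (Lnorm mu p%:E (EFin \o x)).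

(* [powR] gives the value 0 to 0 `^ (p - 2) when p != 2; this is harmless, as
   the integrand is only used when x is nonzero almost everywhere. *)
Definition jp_integrand (T : Type) (R : realType) (p : R) (x y : T -> R)
    (w : T) : R :=
  `|x w| `^ (p - 2) * x w * y w.

Definition jp_pairing (d : measure_display) (T : measurableType d)
    (R : realType) (mu : {measure set T -> \bar R}) (p : R) (x y : T -> R) : R :=
  Lp_norm mu p x `^ (2 - p) * Rintegral mu setT (jp_integrand p x y).

Definition jp_admissible (d : measure_display) (T : measurableType d)
    (R : realType) (mu : {measure set T -> \bar R}) (p : R) (x y : T -> R) : Prop :=
  [/\ in_Lp mu p x, in_Lp mu p y, {ae mu, forall w, x w != 0} &
      mu.-integrable setT (EFin \o jp_integrand p x y)].

Definition tangent_rhs (d : measure_display) (T : measurableType d)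
    (R : realType) (mu : {measure set T -> \bar R}) (p : R) (x y : T -> R) : R :=
  Lp_norm mu p x ^+ 2 + 2 * jp_pairing mu p x y
    + (p - 1) * Lp_norm mu p y ^+ 2.

(* Main.v *)
Require Import Defs.
From mathcomp Require Import all_boot all_order all_algebra.
From mathcomp Require Import all_classical all_reals all_analysis.
From mathcomp Require Import measurable_realfun ring lra.
Import Order.TTheory GRing.Theory Num.Theory.
Local Open Scope classical_set_scope.
Local Open Scope ring_scope.

(** Counterexamples to both directions live on the space of two atoms of
    mass one, where an integral is a sum of two values, and with base point
    the constant function 1, whose norm is N = 2 ^ (1 / p).

    Forward direction: along y = 1 the problem is one-dimensional, the pairing
    is N ^ 2, and the inequality reads 4 N ^ 2 > (p + 2) N ^ 2.

    Reverse direction: take y equal to 1 on one atom and -1 on the other.  The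
    pairing vanishes by symmetry, x + y is 2 on a single atom and so has norm 2,
    while y has norm N.  What remains is 4 < p N ^ 2 = p 4 ^ (1 / p).  There is
    equality at p = 1, and convexity of the exponential makes 4 ^ s exceed 4 s
    as soon as s = 1 / p > 1: this is [two_powR_sqr_gt], which rests on
    ln 4 >= 1. *)

Definition two_atoms (R : realType) : {measure set bool -> \bar R} :=
  measure_add (dirac true) (dirac false).

Lemma measurable_fun_bool (d : measure_display) (T : measurableType d)
  (f : bool -> T) : measurable_fun [set: bool] f.
Proof. by move=> _ B _. Qed.

Lemma ge0_integral_two_atoms (R : realType) (f : bool -> \bar R) :
  (forall b, 0 <= f b)%E ->
  (\int[two_atoms R]_b f b = f true + f false)%E.
Proof.
move=> f0; have mf : measurable_fun [set: bool] f by exact: measurable_fun_bool.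
rewrite ge0_integral_measure_add//.
by rewrite !integral_dirac// !diracE !in_setT !mul1e.
Qed.

Lemma integrable_two_atoms (R : realType) (f : bool -> R) :
  (two_atoms R).-integrable setT (EFin \o f).
Proof.
apply/integrableP; split; first exact: measurable_fun_bool.
by rewrite ge0_integral_two_atoms//= -EFinD ltry.
Qed.

Lemma Rintegral_two_atoms (R : realType) (f : bool -> R) :
  Rintegral (two_atoms R) setT f = f true + f false.
Proof.
have int_dirac a : (dirac a).-integrable setT (EFin \o f).
  apply/integrableP; split; first exact: measurable_fun_bool.
  by rewrite integral_dirac//= diracE in_setT mul1e ltry.
rewrite /Rintegral integral_measure_add//; [|exact: int_dirac..].
by rewrite !integral_dirac// !diracE !in_setT !mul1e.
Qed.

Lemma Lnorm_two_atoms (R : realType) (p : R) (f : bool -> R) :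
  Lnorm (two_atoms R) p%:E (EFin \o f) =
  ((`|f true| `^ p + `|f false| `^ p) `^ p^-1)%:E.
Proof.
rewrite unlock ge0_integral_two_atoms//= => b; exact: poweR_ge0.
Qed.

Lemma Lp_norm_two_atoms (R : realType) (p : R) (f : bool -> R) :
  Lp_norm (two_atoms R) p f =
  (`|f true| `^ p + `|f false| `^ p) `^ p^-1.
Proof. by rewrite /Lp_norm Lnorm_two_atoms. Qed.

Lemma in_Lp_two_atoms (R : realType) (p : R) (f : bool -> R) :
  in_Lp (two_atoms R) p f.
Proof.
split; first exact: measurable_fun_bool.
by rewrite /finite_norm Lnorm_two_atoms ltry.
Qed.

Lemma jp_admissible_two_atoms (R : realType) (p : R) (x y : bool -> R) :
  (forall b, x b != 0) -> jp_admissible (two_atoms R) p x y.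
Proof.
move=> x0; split; [exact: in_Lp_two_atoms..| |exact: integrable_two_atoms].
exact: aeW.
Qed.

Lemma jp_pairing_two_atoms1 (R : realType) (p : R) (y : bool -> R) :
  jp_pairing (two_atoms R) p (cst 1) y =
  Lp_norm (two_atoms R) p (cst 1) `^ (2 - p) * (y true + y false).
Proof.
by rewrite /jp_pairing Rintegral_two_atoms /jp_integrand /= normr1 powR1 !mul1r.
Qed.

(** By [1 + t < expR t] at [t = u * ln 4]; the lower bound [1 <= ln 4] comes
    from [ln (1/2) <= - 1/2]. *)
Lemma one_plus_lt_four_powR (R : realType) (u : R) :
  0 < u -> 1 + u < 4 `^ u.
Proof.
move=> u_gt0.
have ln2_ge : 1 / 2 <= ln (2 : R).
  have /le_ln1Dx : -1 < - (1 / 2) :> R by lra.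
  have -> : 1 + - (1 / 2) = 2^-1 :> R by field.
  by rewrite lnV ?posrE//; lra.
have ln4_ge : 1 <= ln (4 : R).
  have -> : (4 : R) = 2 * 2 by ring.
  by rewrite lnM ?posrE//; lra.
have -> : 4 `^ u = expR (u * ln 4) by rewrite /powR pnatr_eq0.
apply: (@le_lt_trans _ _ (1 + u * ln 4)).
  by rewrite lerD2l ler_peMr// ltW.
by apply: expR_gt1Dx; rewrite mulf_neq0// gt_eqF//; lra.
Qed.

Lemma two_powR_sqr_gt (R : realType) (p : R) :
  0 < p -> p < 1 -> 4 < p * (2 `^ p^-1) ^+ 2.
Proof.
move=> p_gt0 p_lt1.
have -> : (2 `^ p^-1) ^+ 2 = 4 * 4 `^ (p^-1 - 1).
  rewrite expr2 -powRM//; have -> : (2 : R) * 2 = 4 by ring.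
  rewrite -{2}(@powRr1 _ 4)// -powRD ?pnatr_eq0 ?implybT//.
  by congr (_ `^ _); ring.
have : 1 + (p^-1 - 1) < 4 `^ (p^-1 - 1).
  by apply: one_plus_lt_four_powR; rewrite subr_gt0 invf_gt1.
rewrite addrC subrK -(ltr_pM2l p_gt0) divff ?gt_eqF//; lra.
Qed.

Theorem proposition1p4 (R : realType) (p : R) (p_gt0 : 0 < p) (p_lt1 : p < 1) :
  exists (d : measure_display) (T : measurableType d)
    (mu : {measure set T -> \bar R}) (x y x' y' : T -> R),
    [/\ jp_admissible mu p x y,
        jp_admissible mu p x' y',
        Lp_norm mu p (x \+ y) ^+ 2 > tangent_rhs mu p x y &
        Lp_norm mu p (x' \+ y') ^+ 2 < tangent_rhs mu p x' y'].
Proof.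
have p_neq0 : p != 0 by rewrite gt_eqF.
pose N : R := 2 `^ p^-1.
have N_gt0 : 0 < N by exact: powR_gt0.
have norm1 : Lp_norm (two_atoms R) p (cst 1) = N.
  by rewrite Lp_norm_two_atoms /= normr1 powR1.
pose sgn (b : bool) : R := if b then 1 else -1.
exists _, _, (two_atoms R), (cst 1), (cst 1), (cst 1), sgn.
split; [by apply: jp_admissible_two_atoms => b; exact: oner_neq0..| |].
- have norm2 : Lp_norm (two_atoms R) p (cst 1 \+ cst 1) = 2 * N.
    rewrite Lp_norm_two_atoms /= ger0_norm//.
    have -> : (1 + 1) `^ p + (1 + 1) `^ p = 2 `^ p * 2 :> R.
      by rewrite -[1 + 1]/2; ring.
    by rewrite powRM ?powR_ge0// -powRrM mulfV// powRr1.
  (* [N ^ (2 - p) * 2 = N ^ 2], because [N ^ p = 2]. *)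
  have pairing1 : jp_pairing (two_atoms R) p (cst 1) (cst 1) = N ^+ 2.
    rewrite jp_pairing_two_atoms1 norm1 /= -[1 + 1]/2.
    have {2}-> : (2 : R) = N `^ p by rewrite -powRrM mulVf// powRr1.
    by rewrite -powRD ?(gt_eqF N_gt0) ?implybT// subrK powR_mulrn// ltW.
  rewrite /tangent_rhs norm1 norm2 pairing1.
  have := exprn_gt0 2 N_gt0; nra.
- have norm2 : Lp_norm (two_atoms R) p (cst 1 \+ sgn) = 2.
    rewrite Lp_norm_two_atoms /= subrr normr0 powR0// addr0 ger0_norm//.
    by rewrite -powRrM mulfV// powRr1.
  have normy : Lp_norm (two_atoms R) p sgn = N.
    by rewrite Lp_norm_two_atoms /= normrN normr1 powR1.
  rewrite /tangent_rhs norm1 norm2 normy jp_pairing_two_atoms1 subrr !mulr0 addr0.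
  have := two_powR_sqr_gt R p p_gt0 p_lt1; rewrite -/N; lra.
Qed.
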